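(* Let $(X,d,\mu)$ be a complete metric space equipped with a doubling Borel measure $\mu$, suppose that $X$ satisfies an annular decay property, and let $w$ be a weight on $X$. Then $w\in A_\infty(X)\cap RH_\infty(X)$ if and only if $\log w\in BUO(X)$, and in this case $$C\le \exp\left(\|\log w\|_{BUO}\right)\le C\,[w]_\infty,$$ where $C$ is the infimal constant for which $w(x)\le C\,mw(x)$ holds for almost every $x\in X$.
   Context: Balls $B=B(x,r)$ are open, and $2B=B(x,2r)$. The measure $\mu$ is doubling: there is $C_d>1$ such that $0<\mu(2B)\le C_d\,\mu(B)<\infty$ for all balls $B\subset X$. $L^1_{\mathrm{loc}}(X)$ is the set of functions integrable on every compact subset of $X$. Annular decay property: for some $0<\alpha\le 1$ there is $C'\ge 1$ such that for every $x\in X$, $r>0$ and $0<\delta<1$, $\mu(B(x,r)\setminus B(x,(1-\delta)r))\le C'\delta^\alpha\mu(B(x,r))$. A weight is a nonnegative function $w\in L^1_{\mathrm{loc}}(X)$ with $w>0$ $\mu$-a.e. The minimal function of $f\in L^1_{\mathrm{loc}}(X)$ is $mf(x)=\inf_{B\ni x}\frac{1}{\mu(B)}\int_B|f|\,d\mu$, infimum over all balls $B\subset X$ containing $x$. $w\in RH_\infty(X)$ if there is a constant $C<\infty$ with $\operatorname{ess\,sup}_B w\le C\,\frac{1}{\mu(B)}\int_B w\,d\mu$ for every ball $B\subset X$; equivalently, there is $C<\infty$ with $w(x)\le C\,mw(x)$ for a.e. $x\in X$. $w\in A_\infty(X)$ if $[w]_\infty=\sup_B\left(\frac{1}{\mu(B)}\int_B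 w\,d\mu\right)\exp\left(-\frac{1}{\mu(B)}\int_B\log w\,d\mu\right)<\infty$, supremum over all balls $B\subset X$. $f\in L^1_{\mathrm{loc}}(X)$ belongs to $BUO(X)$ if $\|f\|_{BUO}=\sup_B\left(\operatorname{ess\,sup}_B f-\frac{1}{\mu(B)}\int_B f\,d\mu\right)<\infty$, supremum over all balls $B\subset X$. *)

(* Defs.v *)
From HB Require Import structures.
From mathcomp Require Import all_boot all_order all_algebra.
From mathcomp Require Import all_classical all_reals all_analysis.
From mathcomp Require Import ess_sup_inf.

Set Implicit Arguments.
Unset Strict Implicit.
Unset Printing Implicit Defensive.

Import Order.TTheory GRing.Theory Num.Theory.
Import numFieldNormedType.Exports.

Local Open Scope classical_set_scope.
Local Open Scope ring_scope.
Local Open Scope ereal_scope.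

#[short(type="completeMetricType")]
HB.structure Definition CompleteMetric (R : numDomainType) :=
  {T of Complete T & Metric R T}.

Notation borelType X := (g_sigma_algebraType (@open X)).

Section defs.
Context {R : realType} {X : completeMetricType R}.
Variable mu : {measure set (borelType X) -> \bar R}.
Implicit Types (f w : X -> R) (B : set X).

Definition doubling : Prop :=
  exists2 Cd : R, (1 < Cd)%R &
    forall (x : X) (r : R), (0 < r)%R ->
      [/\ 0 < mu (ball x (2 * r)),
          mu (ball x (2 * r)) <= Cd%:E * mu (ball x r) &
          Cd%:E * mu (ball x r) < +oo].

Definition annular_decay : Prop :=
  exists alpha C' : R, [/\ (0 < alpha <= 1)%R, (1 <= C')%R &
    forall (x : X) (r delta : R), (0 < r)%R -> (0 < delta < 1)%R ->
      mu (ball x r `\` ball x ((1 - delta) * r)) <=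
        (C' * delta `^ alpha)%:E * mu (ball x r)].

Definition balls : set (set X) :=
  [set B | exists x : X, exists2 r : R, (0 < r)%R & B = ball x r].

Definition L1loc f : Prop :=
  forall K : set X, compact K -> mu.-integrable K (EFin \o f).

Definition weight w : Prop :=
  [/\ forall x, (0 <= w x)%R, L1loc w & \forall x \ae mu, (0 < w x)%R].

Definition avg f B : \bar R := (mu B)^-1 * \int[mu]_(x in B) (f x)%:E.

(* The extension outside [B] is by [-oo], the neutral element for suprema;
   extending by [0] would be wrong for functions that are negative on [B]. *)
Definition ess_sup_on f B : \bar R :=
  ess_sup mu (patch (cst -oo) B (EFin \o f)).

Definition minimal_fun f (x : X) : \bar R :=
  ereal_inf [set avg (fun y => `|f y|%R) B | B in [set B | balls B /\ B x]].

Definition RH_infty w : Prop :=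
  exists C : R, forall B, balls B -> ess_sup_on w B <= C%:E * avg w B.

Definition RH_infty_cst w : \bar R :=
  ereal_inf [set C%:E | C in
    [set C : R | \forall x \ae mu, (w x)%:E <= C%:E * minimal_fun w x]].

(* [ln] is total with value [0] on nonpositive reals, so [ln \o w] is a genuine
   real-valued function that agrees a.e. with log w when [w] is a weight.  When
   its positive part has finite integral on [B], as is the case for a weight,
   [avg (@ln R \o w) B] may still be [-oo], and then the exponential is [+oo]. *)
Definition A_infty_cst w : \bar R :=
  ereal_sup [set avg w B * expeR (- avg (@ln R \o w) B) | B in balls].

Definition A_infty w : Prop := A_infty_cst w < +oo.

Definition BUO_norm f : \bar R :=
  ereal_sup [set ess_sup_on f B - avg f B | B in balls].

Definition BUO f : Prop := L1loc f /\ BUO_norm f < +oo.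

End defs.

(* Main.v *)
(** Doubling makes balls totally bounded, so the complete space [X] is proper:
    closed balls are compact, locally integrable functions are integrable on
    balls, and countably many balls exhaust every ball from inside.  Through
    this countable family the condition [ess sup_B w <= C avg_B w] for all balls
    [B] becomes the pointwise bound [w <= C m w] a.e., with the same [C].

    Write [L = avg_B (ln w)].  If [ess sup_B w <= C avg_B w] and
    [avg_B w * exp (- L) <= A], then [ess sup_B (ln w) - L <= ln (C A)].
    Conversely, [ess sup_B (ln w) <= K + L] gives
    [ess sup_B w <= exp K * exp L]; bounding [exp L <= avg_B w] by Jensen yields
    RH_infty with constant [exp K], and bounding [avg_B w <= ess sup_B w] yields
    A_infty with constant [exp K]. *)
Require Import Defs.
From mathcomp Require Import all_boot all_order all_algebra.
From mathcomp Require Import all_classical all_reals all_analysis.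
From mathcomp Require Import measurable_realfun ess_sup_inf.
From mathcomp Require Import ring lra.

Set Implicit Arguments.
Unset Strict Implicit.
Unset Printing Implicit Defensive.

Import Order.TTheory GRing.Theory Num.Theory.
Import numFieldNormedType.Exports.

Local Open Scope classical_set_scope.
Local Open Scope ring_scope.
Local Open Scope ereal_scope.

(** * Metric balls as Borel sets *)

Section metric_balls.
Context {R : realType} {X : completeMetricType R}.

Lemma metric_ball_open (x : X) (r : R) : open (ball x r).
Proof.
rewrite openE => y; rewrite ballEmdist /= => xy.
apply/nbhs_ballP; exists (r - mdist x y)%R => /=; first by rewrite subr_gt0.
move=> z; rewrite !ballEmdist /= => yz.
by rewrite (le_lt_trans (metric_triangle x y z))// addrC -ltrBrDr.
Qed.

Lemma metric_ball_eq0 (x : X) (r : R) : (r <= 0)%R -> ball x r = set0.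
Proof.
move=> r0; rewrite -subset0 => y; rewrite ballEmdist /= => xy.
by have := le_lt_trans (mdist_ge0 x y) (lt_le_trans xy r0); rewrite ltxx.
Qed.

Lemma closure_ball_subset (x : X) (r : R) :
  (0 < r)%R -> closure (ball x r) `<=` ball x (2 * r).
Proof.
move=> r0 y /(_ _ (nbhsx_ballx y r r0)) [z [xz yz]].
by rewrite mulrC mulrDr mulr1; apply: ball_triangle xz (ball_sym yz).
Qed.

Lemma borel_ball (x : X) (r : R) :
  measurable (ball x r : set (borelType X)).
Proof. by apply: sub_sigma_algebra; exact: metric_ball_open. Qed.

Lemma borel_compact (K : set X) :
  compact K -> measurable (K : set (borelType X)).
Proof.
move=> cK; rewrite -[K]setCK; apply: measurableC; apply: sub_sigma_algebra.
by apply: closed_openC; apply: compact_closed => //; exact: metric_hausdorff.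
Qed.

End metric_balls.

(** * Doubling measures and properness of the space *)

Section doubling_spaces.
Context {R : realType} {X : completeMetricType R}.
Variable mu : {measure set (borelType X) -> \bar R}.
Hypothesis mu_doubling : doubling mu.

Lemma ball_measure_gt0 (x : X) (r : R) : (0 < r)%R -> 0 < mu (ball x r).
Proof.
move=> r0; case: mu_doubling => C C1 /(_ x (r / 2)%R).
by rewrite (mulrC 2%R) divfK ?pnatr_eq0// => -[|//]; rewrite divr_gt0.
Qed.

Lemma ball_measure_fin (x : X) (r : R) : mu (ball x r) \is a fin_num.
Proof.
have [r0|r0] := ltP 0%R r; last by rewrite metric_ball_eq0// measure0.
rewrite ge0_fin_numE//.
case: mu_doubling => C C1 /(_ x r r0)[_ _].
by apply: le_lt_trans; rewrite lee_pemull// lee_fin ltW.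
Qed.

Lemma ball_measure_geometric : exists2 C : R, (0 < C)%R &
  forall (x : X) (r : R) (k : nat), (0 < r)%R ->
    mu (ball x (2 ^+ k * r)) <= (C ^+ k)%:E * mu (ball x r).
Proof.
case: mu_doubling => C C1 dbl; have C0 : (0 < C)%R by exact: lt_trans C1.
exists C => // x r k r0; elim: k => [|k IH]; first by rewrite !expr0 mul1r mul1e.
have k0 : (0 < 2 ^+ k * r)%R by rewrite mulr_gt0// exprn_gt0.
case: (dbl x _ k0) => _ le1 _; rewrite exprS -mulrA (le_trans le1)//.
by rewrite exprS EFinM -muleA lee_pmul2l.
Qed.

(* The separated centres produced by a failing greedy cover carry disjoint
   half-radius balls whose measures are bounded below, by doubling. *)
Lemma ball_totally_bounded (x : X) (r e : R) : (0 < e)%R ->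
  exists s : seq X, ball x r `<=` \bigcup_(z in [set` s]) ball z e.
Proof.
move=> e0; apply: contrapT => /forallNP nocover.
have r0 : (0 < r)%R.
  rewrite ltNge; apply/negP => r0; apply: (nocover [::]).
  by rewrite metric_ball_eq0.
(* [f s] is a point of [ball x r] left uncovered by the [e]-balls centred in [s]; iterating from the
   empty list gives [e]-separated centres. *)
have /choice[f fP] (s : seq X) :
    exists y, ball x r y /\ forall z, z \in s -> ~ ball z e y.
  have /existsNP[y /not_implyP[xy ny]] := nocover s; exists y; split => //.
  by move=> z zs zy; apply: ny; exists z.
pose s n := iter n (fun s => f s :: s) [::].
pose U n := \big[setU/set0]_(z <- s n) ball z (e / 2).
have mU n : measurable (U n : set (borelType X)).
  by apply: bigsetU_measurable => z _; exact: borel_ball.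
have e20 : (0 < e / 2)%R by rewrite divr_gt0.
have re0 : (0 < r + e)%R by rewrite addr_gt0.
have sx n z : z \in s n -> ball x r z.
  elim: n => //= n IH; rewrite in_cons => /predU1P[->|/IH//].
  by have [] := fP (s n).
have Usub n : U n `<=` ball x (r + e).
  rewrite /U -bigcup_seq => y [z /= zs zy].
  apply: (ball_triangle (sx _ _ zs)); apply: le_ball zy.
  by rewrite ler_pdivrMr// ler_peMr ?ler1n// ltW.
have [C C0 geo] := ball_measure_geometric.
(* [k] is chosen so that, for every [z] in [ball x r], the ball of radius [2 ^+ k * (e / 2)] about
   [z] contains [ball x (r + e)]; [k]-fold doubling then gives the uniform lower bound [M]. *)
have [k kP] : exists k : nat, (r + (r + e) <= 2 ^+ k * (e / 2))%R.
  have := archi_boundP (ltW (divr_gt0 (addr_gt0 r0 re0) e20)).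
  set q := (_ / _)%R => qk; exists (Num.bound q); rewrite -ler_pdivrMr//.
  by apply: (ltW (lt_le_trans qk _)); rewrite -natrX ler_nat ltnW// ltn_expl.
have [M [M0 low]] : exists c : R, (0 < c)%R /\
    forall z, ball x r z -> c%:E <= mu (ball z (e / 2)).
  exists (fine (mu (ball x (r + e))) / C ^+ k)%R; split.
    rewrite divr_gt0 ?exprn_gt0// fine_gt0// ball_measure_gt0//=.
    by rewrite ltey_eq ball_measure_fin.
  move=> z xz; rewrite mulrC EFinM fineK ?ball_measure_fin//.
  rewrite lee_pdivrMl ?exprn_gt0//; apply: le_trans (geo z _ k e20).
  apply: le_measure; rewrite ?inE; do ?exact: borel_ball.
  move=> y xy; apply: le_ball kP _ _; exact: ball_triangle (ball_sym xz) xy.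
have Ulow n : (n%:R * M)%:E <= mu (U n).
  elim: n => [|n IH]; first by rewrite mul0r measure_ge0.
  have -> : mu (U n.+1) = mu (ball (f (s n)) (e / 2)) + mu (U n).
    rewrite /U /= big_cons; apply: measureU; [exact: borel_ball|exact: mU|].
    rewrite -subset0 => y [fy]; rewrite -bigcup_seq => -[z /= zs zy].
    have [_ /(_ z zs)] := fP (s n); apply.
    by rewrite (splitr e); apply: ball_triangle zy (ball_sym fy).
  rewrite -natr1 mulrDl mul1r addrC EFinD leeD// low//.
  by have [] := fP (s n).
have fB : mu (ball x (r + e)) \is a fin_num by exact: ball_measure_fin.
have bnd (m : nat) : (m%:R * M <= fine (mu (ball x (r + e))))%R.
  rewrite -lee_fin fineK// (le_trans (Ulow m))//.
  by apply: le_measure; rewrite ?inE//; exact: borel_ball.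
have := archi_boundP (divr_ge0 (fine_ge0 (measure_ge0 mu (ball x (r + e)))) (ltW M0)).
by rewrite ltr_pdivrMr// ltNge bnd.
Qed.

(** By total boundedness every ultrafilter on the closed ball is Cauchy; completeness provides its
    limit and closedness keeps the limit inside. *)
Lemma closure_ball_compact (x : X) (r : R) : compact (closure (ball x r)).
Proof.
have [r0|r0] := ltP 0%R r; last first.
  by rewrite metric_ball_eq0// closure0; exact: compact0.
rewrite compact_ultra => F FU FB.
have Fc : cauchy F.
  apply: cauchy_exP => e e0.
  have [s sP] := ball_totally_bounded x (2 * r) e0.
  (* If no [e]-ball belonged to [F], the complements of the finitely many covering balls would, and
     so would their intersection, which misses the closed ball. *)
  apply: contrapT => /forallNP nF.
  have : F (~` \bigcup_(z in [set` s]) ball z e).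
    rewrite bigcup_seq; elim: (s) => [|z t IH].
      by rewrite big_nil setC0; exact: filterT.
    rewrite big_cons setCU; apply: filterI => //.
    by have [/nF|] := in_ultra_setVsetC (ball z e) FU.
  move=> /(filterI FB) /filter_ex[y [By]]; apply.
  by apply: sP; exact: closure_ball_subset By.
have /cauchy_cvgP/cvg_ex[l Fl] := Fc.
exists l; split => //.
by apply: closed_closure => B /Fl FlB; exact: filter_ex (filterI FB FlB).
Qed.

End doubling_spaces.

(** * Almost-everywhere statements and essential suprema *)

Section almost_everywhere.
Context d {T : measurableType d} {R : realType}.
Variable mu : {measure set T -> \bar R}.

Lemma ae_imp (P Q : T -> Prop) : (forall x, P x -> Q x) ->
  {ae mu, forall x, P x} -> {ae mu, forall x, Q x}.
Proof. by move=> PQ; apply: filterS. Qed.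

Lemma ae_imp2 (P Q S : T -> Prop) : (forall x, P x -> Q x -> S x) ->
  {ae mu, forall x, P x} -> {ae mu, forall x, Q x} -> {ae mu, forall x, S x}.
Proof. by move=> PQS; apply: filterS2. Qed.

Lemma ess_sup_patchP (f : T -> R) (D : set T) (y : \bar R) :
  ess_sup mu (patch (cst -oo) D (EFin \o f)) <= y <->
  {ae mu, forall x, D x -> (f x)%:E <= y}.
Proof.
split=> [/ess_supP|fy]; last apply/ess_supP.
  by apply: filterS => x + Dx; rewrite /patch mem_set.
move: fy; apply: filterS => x fy.
by rewrite /patch; case: ifPn => [/set_mem//|_]; rewrite leNye.
Qed.

End almost_everywhere.

(** * Integral comparison and Jensen's inequality for the logarithm *)

Section integrals.
Context d {T : measurableType d} {R : realType}.
Variables (mu : {measure set T -> \bar R}) (D : set T).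
Hypothesis mD : measurable D.

Lemma ae_le_integral (f g : T -> \bar R) :
  mu.-integrable D f -> mu.-integrable D g ->
  {ae mu, forall x, D x -> f x <= g x} ->
  \int[mu]_(x in D) f x <= \int[mu]_(x in D) g x.
Proof.
move=> /measurable_int mf /measurable_int mg fg.
rewrite integralE [leRHS]integralE leeB//.
- apply: ae_ge0_le_integral => //; do ?exact: measurable_funepos.
  apply: filterS fg => x + Dx => /(_ Dx) fg.
  by apply: (@funepos_le _ _ [set x]) => [y /[!inE] ->//|]; rewrite inE.
- apply: ae_ge0_le_integral => //; do ?exact: measurable_funeneg.
  apply: filterS fg => x + Dx => /(_ Dx) fg.
  by apply: (@funeneg_le _ _ [set x]) => [y /[!inE] ->//|]; rewrite inE.
Qed.

(** The integrable majorant controls the positive part, so only the negative part can fail to be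
    integrable, and then it drives the integral to [-oo]. *)
Lemma integrable_or_integral_Ny (f g : T -> \bar R) :
  measurable_fun D f -> mu.-integrable D g ->
  (forall x, D x -> f x <= g x) ->
  mu.-integrable D f \/ \int[mu]_(x in D) f x = -oo.
Proof.
move=> mf gi fg.
have fp : mu.-integrable D f^\+.
  apply: le_integrable (gi) => //; first exact: measurable_funepos.
  by move=> x Dx; rewrite gee0_abs// funeposE ge_max abse_ge0 andbT
    (le_trans (fg _ Dx))// lee_abs.
have mfn : measurable_fun D f^\- by exact: measurable_funeneg.
have [fn|nfn] := pselect (mu.-integrable D f^\-).
  by left; rewrite (funeposneg f); exact: integrableB.
right; have fpfin := integrable_fin_num mD fp.
suff fny : \int[mu]_(x in D) f^\- x = +oo by rewrite integralE fny addeNy.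
apply: contrapT => /eqP; rewrite -ltey => fny; apply: nfn.
apply/integrableP; split => //; rewrite (eq_integral (fun x => f^\- x))//.
by move=> x _; rewrite gee0_abs.
Qed.

Lemma ae_exists_in (P : T -> Prop) :
  0 < mu D -> {ae mu, forall x, P x} -> exists2 x, D x & P x.
Proof.
move=> D0 [N [mN N0 PN]]; apply: contrapT => nP.
have : mu D <= mu N.
  apply: le_measure; rewrite ?inE// => x Dx; apply: PN => Px; apply: nP.
  by exists x.
by rewrite N0 leNgt D0.
Qed.

Lemma integral_gt0 (f : T -> \bar R) : measurable_fun D f ->
  0 < mu D -> (forall x, D x -> 0 <= f x) -> {ae mu, forall x, 0 < f x} ->
  0 < \int[mu]_(x in D) f x.
Proof.
move=> mf D0 f0 fgt; rewrite lt0e integral_ge0// andbT; apply/eqP => int0.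
have fabs : \int[mu]_(x in D) `|f x| = 0.
  by rewrite -int0; apply: eq_integral => x /[!inE] /f0; exact: gee0_abs.
have /(ae_eq_integral_abs _ mD mf) ae0 := fabs.
have [x Dx []] := ae_exists_in D0 (filterI fgt ae0).
by move=> fx /(_ Dx) fx0; move: fx; rewrite fx0 ltxx.
Qed.

Hypothesis finD : mu D \is a fin_num.

(** Serves the tangent line in Jensen's inequality and, with [c = 0], the integrability of
    constants. *)
Lemma integrable_affine (u : T -> R) (c k : R) :
  mu.-integrable D (EFin \o u) ->
  mu.-integrable D (fun x => (c * u x + k)%:E) /\
  \int[mu]_(x in D) (c * u x + k)%:E
    = c%:E * \int[mu]_(x in D) (u x)%:E + k%:E * mu D.
Proof.
move=> ui.
have ki : mu.-integrable D (cst k%:E).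
  apply/integrableP; split; first exact: measurable_cst.
  by rewrite /= integral_cst// lte_mul_pinfty// ltey_eq finD.
have cui : mu.-integrable D (fun x => c%:E * (u x)%:E) by exact: integrableZl.
split; first exact: (integrableD mD cui ki).
by rewrite -integralZl// -integral_cst// -integralD.
Qed.

(* Integrate the tangent-line bound exp l (1 + ln w - l) <= w at the mean l. *)
Lemma expR_mean_ln_le (w : T -> R) : 0 < mu D ->
  mu.-integrable D (EFin \o w) -> mu.-integrable D (EFin \o (@ln R \o w)) ->
  {ae mu, forall x, (0 < w x)%R} ->
  (expR (fine (\int[mu]_(x in D) (ln (w x))%:E) / fine (mu D)) <=
   fine (\int[mu]_(x in D) (w x)%:E) / fine (mu D))%R.
Proof.
move=> D0 wi ui w0.
have m0 : (0 < fine (mu D))%R by rewrite fine_gt0// D0 ltey_eq finD.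
have uf := integrable_fin_num mD ui; have wf := integrable_fin_num mD wi.
set l := (_ / _)%R.
have [ai aE] := integrable_affine (expR l) (expR l * (1 - l)) ui.
rewrite ler_pdivlMr// -lee_fin fineK//.
(* Since [l] is the mean of [ln w], the term [ln w - l] integrates to zero. *)
have -> : (expR l * fine (mu D))%:E =
    \int[mu]_(x in D) (expR l * ln (w x) + expR l * (1 - l))%:E.
  rewrite aE -(fineK uf) -[in RHS](fineK finD) -!EFinM -EFinD; congr EFin.
  have -> : fine (\int[mu]_(x in D) (EFin \o (@ln R \o w)) x) = (l * fine (mu D))%R.
    by rewrite /l divfK// gt_eqF.
  by ring.
apply: ae_le_integral => //; apply: filterS w0 => x w0 _.
rewrite lee_fin; apply: (@le_trans _ _ (expR l * expR (ln (w x) - l))%R).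
  have -> : (expR l * ln (w x) + expR l * (1 - l) =
             expR l * (1 + (ln (w x) - l)))%R by ring.
  by rewrite ler_pM2l ?expR_gt0// expR_ge1Dx.
by rewrite -expRD addrC subrK lnK ?posrE.
Qed.

End integrals.

(** * Local integrability, averages and countable families of balls *)

Section weights.
Context {R : realType} {X : completeMetricType R}.
Variable mu : {measure set (borelType X) -> \bar R}.

Lemma ess_sup_onP (f : X -> R) (B : set X) (y : \bar R) :
  ess_sup_on mu f B <= y <-> \forall x \ae mu, B x -> (f x)%:E <= y.
Proof. exact: ess_sup_patchP. Qed.

Hypothesis mu_doubling : doubling mu.

Lemma balls_ball (x : X) (r : R) : (0 < r)%R -> balls (ball x r).
Proof. by move=> r0; exists x, r. Qed.

Lemma balls_measurable (B : set X) : balls B -> measurable (B : set (borelType X)).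
Proof. by move=> [x [r _ ->]]; exact: borel_ball. Qed.

Lemma balls_measure_gt0 (B : set X) : balls B -> 0 < mu B.
Proof. by move=> [x [r r0 ->]]; exact: ball_measure_gt0. Qed.

Lemma balls_measure_fin (B : set X) : balls B -> mu B \is a fin_num.
Proof. by move=> [x [r r0 ->]]; exact: ball_measure_fin. Qed.

Lemma balls_fine_measure_gt0 (B : set X) : balls B -> (0 < fine (mu B))%R.
Proof.
by move=> bB; rewrite fine_gt0// balls_measure_gt0//= ltey_eq balls_measure_fin.
Qed.

Lemma L1loc_integrable (f : X -> R) (B : set X) :
  L1loc mu f -> balls B -> mu.-integrable B (EFin \o f).
Proof.
move=> fL [x [r r0 ->]].
have cB := @closure_ball_compact _ _ _ mu_doubling x r.
apply: integrableS (fL _ cB); [exact: borel_compact|exact: borel_ball|].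
exact: subset_closure.
Qed.

(** A compact set is covered by concentric balls about [point], hence lies in one of them. *)
Lemma integrable_L1loc (f : X -> R) :
  (forall B, balls B -> mu.-integrable B (EFin \o f)) -> L1loc mu f.
Proof.
move=> fB K cK; have mK := borel_compact cK.
have [N KN] : exists N : nat, K `<=` ball (point : X) N.+1%:R.
  have := cK; rewrite compact_cover => /(_ nat setT (fun n => ball (point : X) n.+1%:R)).
  case=> [n _|x Kx|D _ KD]; first exact: metric_ball_open.
    exists (Num.bound (mdist point x)) => //; rewrite ballEmdist /=.
    by rewrite (lt_trans (archi_boundP (mdist_ge0 _ _)))// ltr_nat.
  exists (\max_(i <- finmap.enum_fset D) i)%N => x /KD [i /= iD]; apply: le_ball.
  by rewrite ler_nat ltnS (leq_bigmax_seq i).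
apply: integrableS (fB _ (balls_ball point (ltr0Sn _ N))) => //.
exact: borel_ball.
Qed.

Lemma avg_integrable (f : X -> R) (B : set X) :
  balls B -> mu.-integrable B (EFin \o f) ->
  avg mu f B = (fine (\int[mu]_(x in B) (f x)%:E) / fine (mu B))%:E.
Proof.
move=> bB fi; have mB := balls_measurable bB.
have m0 := balls_fine_measure_gt0 bB.
rewrite /avg -(fineK (integrable_fin_num mB fi)) -[in LHS](fineK (balls_measure_fin bB)).
by rewrite inver gt_eqF// -EFinM mulrC.
Qed.

Lemma countable_inner_balls : exists E : nat -> set X,
  (forall n, balls (E n)) /\
  forall (x : X) (s r : R), (0 < s < r)%R ->
    exists n, ball x s `<=` E n /\ E n `<=` ball x r.
Proof.
(* [S n] is a finite net of mesh [n.+1%:R^-1] in the ball of radius [n] about [point]. The family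
   takes its centres from these nets and its radii from the rationals. *)
have /choice[S SP] (n : nat) : exists S : seq X,
    ball (point : X) n%:R `<=` \bigcup_(z in [set` S]) ball z n.+1%:R^-1.
  by apply: ball_totally_bounded mu_doubling _ _ _ _; rewrite invr_gt0.
(* Nonpositive rationals are sent to radius 1, so every index, including the default for invalid
   codes, yields a genuine ball. *)
pose rad (q : rat) : R := if (0 < ratr q :> R)%R then ratr q else 1%R.
pose F (i : nat * nat * rat) : set X := ball (nth point (S i.1.1) i.1.2) (rad i.2).
exists (fun k => F (odflt (0%N, 0%N, 0%R) (unpickle k))); split=> [k|x s r /andP[s0 sr]].
  by apply: balls_ball; rewrite /rad; case: ifPn.
(* A third of the gap leaves a rational [q] between [s + e] and [r - e]; a centre within [e] of [x]
   then gives both inclusions. *)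
pose e : R := ((r - s) / 3)%R.
have e0 : (0 < e)%R by rewrite divr_gt0// subr_gt0.
have [q] := @rat_in_itvoo R (s + e)%R (r - e)%R ltac:(rewrite /e; lra).
rewrite in_itv /= => /andP[sq qr].
have q0 : (0 < ratr q :> R)%R by rewrite (lt_trans _ sq)// addr_gt0.
pose n := (Num.bound (mdist point x) + Num.bound e^-1)%N.
have xn : ball (point : X) n%:R x.
  rewrite ballEmdist /= (lt_le_trans (archi_boundP (mdist_ge0 _ _)))//.
  by rewrite ler_nat leq_addr.
have ne : (n.+1%:R^-1 <= e)%R.
  rewrite -[leRHS]invrK lef_pV2 ?posrE ?invr_gt0//.
  have e1 : (0 <= e^-1)%R by rewrite invr_ge0 ltW.
  by rewrite (le_trans (ltW (archi_boundP e1)))// ler_nat leqW// leq_addl.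
have [z /= zS zx] := SP n x xn.
exists (pickle (n, index z (S n), q)); rewrite pickleK /= /F /= nth_index//.
rewrite /rad q0; have {}zx : ball z e x by exact: le_ball zx.
split=> y.
  by move=> xy; apply: (le_ball (ltW sq)); rewrite addrC; exact: ball_triangle zx xy.
move=> zy; apply: (@le_ball _ _ _ (e + ratr q)%R); first by lra.
exact: ball_triangle (ball_sym zx) zy.
Qed.

(** Continuity of the measure from below: an open ball is the increasing union of its smaller
    concentric balls. *)
Lemma ball_measure_le (x : X) (t r : R) (y : \bar R) : (t < r)%R ->
  (forall s, (t < s < r)%R -> mu (ball x s) <= y) -> mu (ball x r) <= y.
Proof.
move=> tr muy.
(* The denominator [k.+2] keeps [s k] strictly above [t] already at [k = 0]. *)
pose s (k : nat) : R := (r - (r - t) / k.+2%:R)%R.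
have rt0 : (0 < r - t)%R by rewrite subr_gt0.
have sP k : (t < s k < r)%R.
  rewrite /s; apply/andP; split; last by rewrite gtrBl divr_gt0.
  by rewrite ltrBrDr -ltrBrDl ltr_pdivrMr// ltr_pMr// ltr1n.
pose F k : set (borelType X) := ball x (s k).
have mF k : measurable (F k) by exact: borel_ball.
have bigF : \bigcup_k F k = ball x r.
  apply/seteqP; split=> [y' [k _]|z xz].
    by apply: le_ball; case/andP: (sP k) => _ /ltW.
  move: xz; rewrite ballEmdist /= -subr_gt0 => xz.
  have := archi_boundP (divr_ge0 (ltW rt0) (ltW xz)); rewrite ltr_pdivrMr// => bd.
  exists (Num.bound ((r - t) / (r - mdist x z))) => //.
  rewrite /F ballEmdist /= /s ltrBrDr addrC -ltrBrDr ltr_pdivrMr//.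
  rewrite mulrC (lt_le_trans bd)// ler_pM2r// ler_nat.
  by rewrite -addn2 leq_addr.
have ndF : nondecreasing_seq F.
  move=> m n mn; rewrite subsetEset; apply: le_ball.
  rewrite /s lerD2l lerN2 ler_pM2l// lef_pV2 ?posrE//.
  by rewrite ler_nat !ltnS.
have mbig : measurable (\bigcup_k F k) by rewrite bigF; exact: borel_ball.
have cv := nondecreasing_cvg_mu (mu := mu) mF mbig ndF.
rewrite -bigF -(cvg_lim _ cv)//; apply: lime_le; first by apply/cvg_ex; eexists; exact: cv.
by apply: nearW => k; exact: muy.
Qed.

End weights.

(** * Constants of the three conditions compared *)

Section equivalence.
Context {R : realType} {X : completeMetricType R}.
Variables (mu : {measure set (borelType X) -> \bar R}) (w : X -> R).
Hypothesis mu_doubling : doubling mu.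
Hypothesis w_weight : weight mu w.

Let w_ge0 x : (0 <= w x)%R. Proof. by case: w_weight. Qed.
Let w_gt0 : {ae mu, forall x, (0 < w x)%R}. Proof. by case: w_weight. Qed.

Let w_int B : balls B -> mu.-integrable B (EFin \o w).
Proof. by case: w_weight => _ wL _; exact: L1loc_integrable. Qed.

Lemma A_infty_cst_ge B : balls B ->
  avg mu w B * expeR (- avg mu (@ln R \o w) B) <= A_infty_cst mu w.
Proof. by move=> bB; apply: ereal_sup_ubound; exists B. Qed.

Lemma BUO_norm_ge (f : X -> R) B : balls B ->
  ess_sup_on mu f B - avg mu f B <= BUO_norm mu f.
Proof. by move=> bB; apply: ereal_sup_ubound; exists B. Qed.

Lemma avg_normr : avg mu (fun x => `|w x|)%R = avg mu w.
Proof. by congr avg; apply/funext => x; rewrite ger0_norm. Qed.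

Lemma avg_weight_gt0 B : balls B -> 0 < avg mu w B.
Proof.
move=> bB; have mB := balls_measurable bB.
have B0 := balls_measure_gt0 mu_doubling bB.
have Bf := balls_measure_fin mu_doubling bB.
have i0 : 0 < \int[mu]_(x in B) (w x)%:E.
  apply: integral_gt0 => //; first exact: measurable_int (w_int bB).
  by move=> x _; rewrite lee_fin.
rewrite avg_integrable//; last exact: w_int.
rewrite lte_fin divr_gt0// fine_gt0 ?i0 ?B0//= ltey_eq ?Bf//.
by rewrite (integrable_fin_num mB (w_int bB)).
Qed.

Lemma avg_weight_fin B : balls B -> avg mu w B \is a fin_num.
Proof. by move=> bB; rewrite avg_integrable//; exact: w_int. Qed.

(* A bound on the averages over countably many balls passes to every ball
   containing x, because each ball is exhausted in measure by balls of the
   countable family. *)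
Lemma ess_sup_le_minimal_fun (C : R) : (0 < C)%R ->
  (forall B, balls B -> ess_sup_on mu w B <= C%:E * avg mu w B) <->
  \forall x \ae mu, (w x)%:E <= C%:E * minimal_fun mu w x.
Proof.
move=> C0; split=> [RH|wC B bB]; last first.
  apply/ess_sup_onP; apply: ae_imp wC => x wx Bx; apply: (le_trans wx).
  rewrite lee_pmul2l//; apply: ereal_inf_lbound; exists B => //.
  by rewrite avg_normr.
have [E [bE Einner]] := countable_inner_balls mu_doubling.
have aeE n : {ae mu, forall x, E n x -> (w x)%:E <= C%:E * avg mu w (E n)}.
  by apply/ess_sup_onP; exact: RH.
(* Countability merges the exceptional sets into a single null set. *)
have {aeE} := ae_foralln aeE.
apply: ae_imp => x wE; rewrite -lee_pdivrMl//.
apply: le_ereal_inf_tmp => _ [B [bB Bx] <-].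
rewrite avg_normr lee_pdivrMl//.
have bB' := bB; case: bB' => z [r r0 BE].
have mB := balls_measure_fin mu_doubling bB.
have m0 := balls_fine_measure_gt0 mu_doubling bB.
have iB := integrable_fin_num (balls_measurable bB) (w_int bB).
have := w_ge0 x; rewrite le_eqVlt => /predU1P[<-|wx0].
  by rewrite mule_ge0 ?lee_fin ?ltW// avg_weight_gt0.
rewrite avg_integrable//; last exact: w_int.
(* Dividing by [w x > 0] turns the claim into an upper bound on [mu B], which can be tested on
   concentric inner balls. Their radii exceed [mdist z x], so they still contain [x]. *)
rewrite -EFinM lee_fin mulrA ler_pdivlMr// -ler_pdivlMl// -lee_fin fineK//.
have zx : (mdist z x < r)%R by move: Bx; rewrite BE ballEmdist.
rewrite [X in mu X]BE; apply: (ball_measure_le zx) => s /andP[zxs sr].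
have s0 : (0 < s)%R by exact: le_lt_trans (mdist_ge0 z x) zxs.
have [n [sE Er]] := Einner z s r ltac:(by rewrite s0 sr).
have En := bE n; have mEn := balls_measure_fin mu_doubling En.
apply: (@le_trans _ _ (mu (E n))).
  apply: le_measure => //; rewrite inE; first exact: borel_ball.
  exact: balls_measurable.
have Enx : E n x by apply: sE; rewrite ballEmdist.
have m0n := balls_fine_measure_gt0 mu_doubling En.
have iE := integrable_fin_num (balls_measurable En) (w_int En).
have := wE n Enx; rewrite avg_integrable//; last exact: w_int.
rewrite -EFinM lee_fin mulrA ler_pdivlMr// -ler_pdivlMl// => wEn.
rewrite -(fineK mEn) lee_fin (le_trans wEn)// ler_pM2l ?invr_gt0// ler_pM2l//.
apply: fine_le => //; apply: ge0_subset_integral.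
- exact: balls_measurable.
- exact: balls_measurable.
- exact: measurable_int (w_int bB).
- by move=> y _; rewrite lee_fin.
- by rewrite BE.
Qed.

(** [RH_infty] admits any real constant; positivity, required for [ln (C * A)], is forced by
    evaluating at a point of [B] where [w > 0]. *)
Lemma ess_sup_avg_cst_gt0 (C : R) B : balls B ->
  ess_sup_on mu w B <= C%:E * avg mu w B -> (0 < C)%R.
Proof.
move=> bB /ess_sup_onP wC.
have B0 := balls_measure_gt0 mu_doubling bB.
have [x Bx [wx0 /(_ Bx) wx]] := ae_exists_in (balls_measurable bB) B0
  (ae_imp2 (fun x => @conj _ _) w_gt0 wC).
have : 0 < C%:E * avg mu w B by apply: lt_le_trans wx; rewrite lte_fin.
by rewrite pmule_lgt0 ?lte_fin//; exact: avg_weight_gt0.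
Qed.

Lemma minimal_fun_ge0 x : 0 <= minimal_fun mu w x.
Proof.
apply: le_ereal_inf_tmp => _ [B [bB _] <-].
by rewrite avg_normr ltW// avg_weight_gt0.
Qed.

Lemma minimal_fun_cst_gt0 (C : R) :
  (\forall x \ae mu, (w x)%:E <= C%:E * minimal_fun mu w x) -> (0 < C)%R.
Proof.
move=> wC; have bB := balls_ball (point : X) (@ltr01 R).
have [x _ [wx0 wx]] := ae_exists_in (balls_measurable bB)
  (balls_measure_gt0 mu_doubling bB) (ae_imp2 (fun x => @conj _ _) w_gt0 wC).
rewrite ltNge; apply/negP => C0.
have : C%:E * minimal_fun mu w x <= 0.
  by rewrite mule_le0_ge0 ?lee_fin// minimal_fun_ge0.
by move=> /(le_trans wx); rewrite lee_fin leNgt wx0.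
Qed.

(** As [ln w <= w], a failure of integrability means that the average of [ln w] is [-oo]; the
    average of [w] being positive, the [A_infty] constant would be [+oo]. *)
Lemma ln_integrable B : balls B -> A_infty mu w ->
  mu.-integrable B (EFin \o (@ln R \o w)).
Proof.
move=> bB Ainf; have mB := balls_measurable bB.
have mln : measurable_fun (B : set (borelType X)) (EFin \o (@ln R \o w)).
  apply/measurable_EFinP; apply: measurableT_comp; first exact: measurable_ln.
  by apply/measurable_EFinP; exact: measurable_int (w_int bB).
have lnw x : B x -> (EFin \o (@ln R \o w)) x <= (EFin \o w) x.
  move=> _ /=; rewrite lee_fin; have := w_ge0 x.
  (* Where [w] vanishes, the bound relies on the default value [ln 0 = 0]. *)
  rewrite le_eqVlt => /predU1P[<-|wx]; first by rewrite ln0.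
  by rewrite ltW// ln_sublinear.
have [//|intNy] := integrable_or_integral_Ny mB mln (w_int bB) lnw.
have avgNy : avg mu (@ln R \o w) B = -oo.
  rewrite /avg intNy -(fineK (balls_measure_fin mu_doubling bB)).
  have m0 := balls_fine_measure_gt0 mu_doubling bB.
  by rewrite inver gt_eqF// gt0_muleNy// lte_fin invr_gt0.
have : A_infty_cst mu w = +oo.
  apply/eqP; rewrite -leye_eq; apply: ereal_sup_ubound; exists B => //.
  by rewrite avgNy /= gt0_muley// avg_weight_gt0.
by move=> Ay; move: Ainf; rewrite /A_infty Ay ltxx.
Qed.

Lemma expR_avg_ln_le B : balls B -> mu.-integrable B (EFin \o (@ln R \o w)) ->
  (expR (fine (avg mu (@ln R \o w) B)) <= fine (avg mu w B))%R.
Proof.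
move=> bB ui; rewrite !avg_integrable//; last exact: w_int.
apply: expR_mean_ln_le => //; first exact: balls_measurable.
- exact: balls_measure_fin.
- exact: balls_measure_gt0.
- exact: w_int.
Qed.

Lemma BUO_norm_ln_le (C A : R) : (0 < C)%R ->
  (forall B, balls B -> mu.-integrable B (EFin \o (@ln R \o w))) ->
  (forall B, balls B -> ess_sup_on mu w B <= C%:E * avg mu w B) ->
  A_infty_cst mu w <= A%:E ->
  BUO_norm mu (@ln R \o w) <= (ln (C * A))%:E.
Proof.
move=> C0 ui RH Aub; apply: ge_ereal_sup => _ [B bB <-].
have a0 := avg_weight_gt0 bB; have af := avg_weight_fin bB.
have := A_infty_cst_ge bB => /le_trans/(_ Aub); move: (RH B bB).
rewrite [avg mu (@ln R \o w) B]avg_integrable//; last exact: ui.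
set l := (_ / _)%R.
rewrite -(fineK af) /= in a0 *; set a := fine _ in a0 *.
rewrite lte_fin in a0.
rewrite -!EFinM lee_fin => /ess_sup_onP wC lA.
have A0 : (0 < A)%R by apply: lt_le_trans lA; rewrite mulr_gt0 ?expR_gt0.
rewrite EFinN leeBlDr// -EFinD; apply/ess_sup_onP.
apply: ae_imp2 w_gt0 wC => x wx /[apply]; rewrite !lee_fin => wCa /=.
rewrite -ler_expR lnK ?posrE// expRD lnK ?posrE ?mulr_gt0//.
(* What remains is [a <= A * expR l], the [A_infty] bound on [B]. *)
rewrite (le_trans wCa)// -mulrA ler_pM2l// -ler_pdivrMr ?expR_gt0//.
by rewrite -expRN.
Qed.

Section BUO_bound.
Variable K : R.
Hypothesis ui : forall B, balls B -> mu.-integrable B (EFin \o (@ln R \o w)).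
Hypothesis K_ub : BUO_norm mu (@ln R \o w) <= K%:E.

(** The norm bound exponentiated; both the reverse Hölder and the [A_infty] estimates start from
    it. *)
Lemma ess_sup_weight_le B : balls B ->
  ess_sup_on mu w B <= (expR K * expR (fine (avg mu (@ln R \o w) B)))%:E.
Proof.
move=> bB.
have := BUO_norm_ge (@ln R \o w) bB => /le_trans/(_ K_ub).
rewrite avg_integrable//; last exact: ui.
rewrite leeBlDr// -EFinD => /ess_sup_onP lnK'; apply/ess_sup_onP.
apply: ae_imp2 w_gt0 lnK' => x wx /[apply]; rewrite !lee_fin /= => lnw.
by rewrite -expRD -[leLHS]lnK ?posrE// ler_expR.
Qed.

Lemma BUO_RH_infty B : balls B -> ess_sup_on mu w B <= (expR K)%:E * avg mu w B.
Proof.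
move=> bB; apply: (le_trans (ess_sup_weight_le bB)).
rewrite -(fineK (avg_weight_fin bB)) -EFinM lee_fin ler_pM2l ?expR_gt0//.
by apply: expR_avg_ln_le => //; exact: ui.
Qed.

Lemma avg_le_ess_sup B : balls B ->
  forall y : R, ess_sup_on mu w B <= y%:E -> (fine (avg mu w B) <= y)%R.
Proof.
move=> bB y /ess_sup_onP wy.
have mB := balls_measurable bB; have Bf := balls_measure_fin mu_doubling bB.
have m0 := balls_fine_measure_gt0 mu_doubling bB.
rewrite avg_integrable//; last exact: w_int.
rewrite /= ler_pdivrMr// -lee_fin fineK ?(integrable_fin_num mB (w_int bB))//.
have [ci cE] := integrable_affine mB Bf 0 y (w_int bB).
rewrite EFinM fineK// -integral_cst//.
apply: ae_le_integral => //; first exact: w_int.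
by apply: eq_integrable ci => // x _; rewrite mul0r add0r.
Qed.

Lemma BUO_A_infty : A_infty_cst mu w <= (expR K)%:E.
Proof.
apply: ge_ereal_sup => _ [B bB <-].
have := avg_le_ess_sup bB (ess_sup_weight_le bB).
rewrite -(fineK (avg_weight_fin bB)).
rewrite [avg mu (@ln R \o w) B]avg_integrable//; last exact: ui.
by rewrite /= -EFinM lee_fin expRN ler_pdivrMr ?expR_gt0.
Qed.

End BUO_bound.

(** With the upper bound in [BUO], this makes the norm a real number: a norm [-oo] would force
    [ln w <= -oo] somewhere on a ball of positive measure. *)
Lemma BUO_norm_gtNy :
  (forall B, balls B -> mu.-integrable B (EFin \o (@ln R \o w))) ->
  -oo < BUO_norm mu (@ln R \o w).
Proof.
move=> ui; have bB := balls_ball (point : X) (@ltr01 R).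
rewrite ltNye; apply/eqP => bNy.
have := BUO_norm_ge (@ln R \o w) bB; rewrite bNy avg_integrable//; last exact: ui.
rewrite leeBlDr// addNye => /ess_sup_onP lnNy.
have [x Bx /(_ Bx)] := ae_exists_in (balls_measurable bB)
  (balls_measure_gt0 mu_doubling bB) lnNy.
by rewrite leeNy_eq.
Qed.

Lemma A_infty_cst_gt0 :
  (forall B, balls B -> mu.-integrable B (EFin \o (@ln R \o w))) ->
  0 < A_infty_cst mu w.
Proof.
move=> ui; have bB := balls_ball (point : X) (@ltr01 R).
apply: lt_le_trans (A_infty_cst_ge bB).
rewrite mule_gt0 ?avg_weight_gt0// avg_integrable//; last exact: ui.
by rewrite lte_fin expR_gt0.
Qed.

End equivalence.

(** * The equivalence and the two-sided estimate of the constants *)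

Theorem theorem5p2 (R : realType) (X : completeMetricType R)
    (mu : {measure set (borelType X) -> \bar R}) (w : X -> R)
    (mu_doubling : doubling mu) (mu_annular : annular_decay mu)
    (w_weight : weight mu w) :
  (A_infty mu w /\ RH_infty mu w <-> BUO mu (@ln R \o w)) /\
  (BUO mu (@ln R \o w) ->
    RH_infty_cst mu w <= expeR (BUO_norm mu (@ln R \o w)) /\
    expeR (BUO_norm mu (@ln R \o w)) <= RH_infty_cst mu w * A_infty_cst mu w).
Proof.
have BUO_fin : BUO mu (@ln R \o w) ->
    (forall B, balls B -> mu.-integrable B (EFin \o (@ln R \o w))) /\
    exists K, BUO_norm mu (@ln R \o w) = K%:E.
  move=> [uL uy].
  have ui B : balls B -> mu.-integrable B (EFin \o (@ln R \o w)).
    exact: L1loc_integrable.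
  split => //; exists (fine (BUO_norm mu (@ln R \o w))); rewrite fineK//.
  by rewrite fin_numElt BUO_norm_gtNy.
split; [split=> [[Ainf [C RH]]|bu]|move=> bu].
- have ui B : balls B -> mu.-integrable B (EFin \o (@ln R \o w)).
    by move=> bB; exact: (ln_integrable mu_doubling).
  have A0 : 0 < A_infty_cst mu w by exact: A_infty_cst_gt0.
  split; first exact: integrable_L1loc.
  have bB := balls_ball (point : X) (@ltr01 R).
  have C0 := ess_sup_avg_cst_gt0 mu_doubling w_weight bB (RH _ bB).
  have Af : A_infty_cst mu w \is a fin_num by rewrite fin_numElt Ainf (lt_trans _ A0).
  apply: (@le_lt_trans _ _ (ln (C * fine (A_infty_cst mu w)))%:E); last exact: ltry.
  by apply: BUO_norm_ln_le => //; rewrite fineK.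
- have [ui [K KE]] := BUO_fin bu.
  have K_ub : BUO_norm mu (@ln R \o w) <= K%:E by rewrite KE.
  split; last by exists (expR K) => B; exact: BUO_RH_infty.
  by apply: le_lt_trans (BUO_A_infty mu_doubling w_weight ui K_ub) _; exact: ltry.
have [ui [K KE]] := BUO_fin bu.
have K_ub : BUO_norm mu (@ln R \o w) <= K%:E by rewrite KE.
rewrite KE /=; split.
  (* [expR K] is itself an admissible constant in the infimum. *)
  apply: ereal_inf_lbound; exists (expR K) => //=.
  by apply/ess_sup_le_minimal_fun; rewrite ?expR_gt0// => B; exact: BUO_RH_infty.
have A0 : 0 < A_infty_cst mu w by exact: A_infty_cst_gt0.
have Af : A_infty_cst mu w \is a fin_num.
  rewrite fin_numElt (lt_trans _ A0)//=.
  by apply: le_lt_trans (BUO_A_infty mu_doubling w_weight ui K_ub) _; exact: ltry.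
have a0 : (0 < fine (A_infty_cst mu w))%R by rewrite fine_gt0// A0 ltey_eq Af.
(* Dividing by the positive finite [A_infty] constant isolates the infimum, so it suffices to treat
   each admissible [C] separately. *)
rewrite -(fineK Af) -lee_pdivrMr//; apply: le_ereal_inf_tmp => _ [C /= wC <-].
have C0 := minimal_fun_cst_gt0 mu_doubling w_weight wC.
rewrite lee_pdivrMr// -EFinM lee_fin.
have RH := (ess_sup_le_minimal_fun mu_doubling w_weight C0).2 wC.
have Aub : A_infty_cst mu w <= (fine (A_infty_cst mu w))%:E by rewrite fineK.
have := BUO_norm_ln_le mu_doubling w_weight C0 ui RH Aub.
by rewrite KE lee_fin -ler_expR lnK ?posrE ?mulr_gt0.
Qed.
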